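(* Let $\mathbb{D}$ be a countable set, $S\subseteq\mathbb{D}$ a finite set and $n\in\mathbb{N}$. A function $H:S\times\mathbb{D}\to\mathbb{N}$ is a histogram over $S$ of degree $n$ if and only if $H$ is the (pointwise) sum of $n$ simple histograms over $S$.
   Context: A histogram over a finite set $S\subseteq\mathbb{D}$ is a total function $H:S\times\mathbb{D}\to\mathbb{N}$ for which there is $n\in\mathbb{N}$ (its degree) such that (1) $\sum_{\beta\in\mathbb{D}}H(\alpha,\beta)=n$ for every $\alpha\in S$, and (2) $\sum_{\alpha\in S}H(\alpha,\beta)\le n$ for every $\beta\in\mathbb{D}$. A histogram of degree $1$ is called simple. Histograms over the same $S$ are summed pointwise. *)

(* Defs.v *)
From mathcomp Require Import all_boot finmap.

Set Implicit Arguments.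
Unset Strict Implicit.
Unset Printing Implicit Defensive.

(* [has_sum f n]: the possibly infinite sum of the f x, x ranging over D,
   converges to n.  It is the limit in the discrete space nat of the net of
   partial sums over finite subsets of D ordered by inclusion, so that
   eventually constant is the same as convergent. *)
Definition has_sum (D : choiceType) (f : D -> nat) (n : nat) : Prop :=
  exists A : {fset D},
    forall B : {fset D}, (A `<=` B)%fset -> \sum_(x <- B) f x = n.

Definition histogram (D : choiceType) (S : {fset D}) (n : nat)
    (H : S * D -> nat) : Prop :=
  (forall a : S, has_sum (fun b : D => H (a, b)) n) /\
  (forall b : D, \sum_(a : S) H (a, b) <= n).

Definition simple_histogram (D : choiceType) (S : {fset D})
    (H : S * D -> nat) : Prop :=
  histogram 1 H.

(* Main.v *)
Require Import Defs.
From mathcomp Require Import all_boot finmap zify.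

(** Only finitely many columns of a histogram [H] of degree [n] are nonzero.
    With [B] the set of these columns, the symmetric matrix
    [[0, H], [H^T, diag (n - column sums of H)]], indexed by [S + B], has all row
    and column sums equal to [n].  By Hall's theorem such a matrix is a sum of
    [n] permutation matrices (Koenig), and the upper right blocks of these are the
    simple histograms. *)

Definition hall_condition {I T : finType} (F : I -> {set T}) : Prop :=
  forall X : {set I}, #|X| <= #|\bigcup_(i in X) F i|.

Definition shrink {I T : finType} (F : I -> {set T}) (i : I) (x : T) (j : I) :=
  if j == i then F j :\ x else F j.

Lemma shrink_sub {I T : finType} (F : I -> {set T}) i x j :
  shrink F i x j \subset F j.
Proof. by rewrite /shrink; case: ifP => // _; apply: subsetDl. Qed.

(** Over an index set avoiding [i] the shrunken family agrees with [F], so a violating set must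
    contain [i]. *)
Lemma not_hall_shrink {I T : finType} (F : I -> {set T}) (i : I) (x : T) :
  hall_condition F ->
  [exists X : {set I}, #|\bigcup_(j in X) shrink F i x j| < #|X|] ->
  exists2 X : {set I},
    i \in X & #|\bigcup_(j in X) shrink F i x j| < #|X|.
Proof.
move=> hF /existsP [X hX]; exists X => //; apply/negPn/negP => iX.
move: hX; rewrite ltnNge; case/negP.
rewrite (eq_bigr F) ?hF // => j jX; rewrite /shrink.
by case: eqP => // ji; rewrite -ji jX in iX.
Qed.

(* Rado: if both removals violated Hall's condition, submodularity of the
   neighbourhood size would make [F] violate it too. *)
Lemma hall_shrink {I T : finType} (F : I -> {set T}) (i : I) (x y : T) :
  hall_condition F -> x != y ->
  hall_condition (shrink F i x) \/ hall_condition (shrink F i y).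
Proof.
move=> hF xy.
case: (boolP [exists X : {set I}, #|\bigcup_(j in X) shrink F i x j| < #|X|]);
  last by move/existsPn=> h; left=> X; rewrite leqNgt h.
case: (boolP [exists X : {set I}, #|\bigcup_(j in X) shrink F i y j| < #|X|]);
  last by move/existsPn=> h _; right=> X; rewrite leqNgt h.
move=> /not_hall_shrink-/(_ hF) [Y iY hY] /not_hall_shrink-/(_ hF) [X iX hX].
exfalso; move: hX hY.
set P := \bigcup_(j in X) _; set Q := \bigcup_(j in Y) _ => hX hY.
have subU : \bigcup_(j in X :|: Y) F j \subset P :|: Q.
  apply/subsetP => z /bigcupP [j jXY zj]; rewrite inE.
  (* As [x != y], each element of [F i] survives at least one of the two removals. *)
  have [ji|ji] := eqVneq j i.
    have [zx|zx] := eqVneq z x.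
      apply/orP; right; apply/bigcupP; exists i => //.
      by rewrite /shrink eqxx !inE zx xy -zx -ji.
    apply/orP; left; apply/bigcupP; exists i => //.
    by rewrite /shrink eqxx !inE zx -ji.
  move: jXY; rewrite inE => /orP [jX|jY]; apply/orP; [left|right];
    by apply/bigcupP; exists j => //; rewrite /shrink (negPf ji).
have subI : \bigcup_(j in (X :&: Y) :\ i) F j \subset P :&: Q.
  apply/subsetP => z /bigcupP [j]; rewrite !inE => /and3P [ji jX jY] zj.
  by apply/andP; split; apply/bigcupP; exists j => //; rewrite /shrink (negPf ji).
have hU := leq_trans (hF _) (subset_leq_card subU).
have hI := leq_trans (hF _) (subset_leq_card subI).
(* Adding [hU] and [hI] gives $|X|+|Y|-1\le|P|+|Q|$, where the $1$ is the index [i]; but [hX] and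
   [hY] give $|P|+|Q|\le|X|+|Y|-2$. *)
have := cardsUI X Y; have := cardsUI P Q; have := cardsD1 i (X :&: Y).
rewrite inE iX iY /=; lia.
Qed.

(** Induction on the total size of the sets: while some [F i] has two elements, [hall_shrink] allows
    one of them to be removed. Once all sets are singletons, the condition on pairs of indices
    forces them to be distinct. *)
Lemma hall {I T : finType} (F : I -> {set T}) :
  hall_condition F ->
  exists f : I -> T, injective f /\ forall i, f i \in F i.
Proof.
have [m] := ubnP (\sum_i #|F i|); elim: m F => // m IHm F hm hF.
have [/existsP [i]|/existsPn F1] := boolP [exists i, 1 < #|F i|].
  case/card_gt1P=> x [y [xF yF xy]].
  have step z : z \in F i -> hall_condition (shrink F i z) ->
      exists f : I -> T, injective f /\ forall i, f i \in F i.
    move=> zF hz; case: (IHm _ _ hz) => [|f [injf fF]]; last first.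
      by exists f; split=> // j; apply: subsetP (shrink_sub F i z j) _ (fF j).
    move: hm; rewrite ltnS; apply: leq_trans.
    rewrite (bigD1 i) //= [ltnRHS](bigD1 i) //=.
    rewrite -addSn leq_add //.
      by rewrite {1}/shrink eqxx (cardsD1 z (F i)) zF.
    by apply: leq_sum => j _; apply: subset_leq_card; apply: shrink_sub.
  by have [/step|/step] := hall_shrink F i x y hF xy; apply.
have F_ex i : exists x, x \in F i.
  apply/set0Pn; rewrite -card_gt0.
  by have := hF [set i]; rewrite big_set1 cards1.
have [f fF] := fin_all_exists F_ex; exists f; split=> // i j fij.
apply/eqP; apply: contraT => ij.
have := hF [set i; j]; rewrite cards2 ij big_setU1 ?inE //= big_set1.
suff -> : F i :|: F j = F i by rewrite ltnNge leqNgt F1.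
apply/setUidPl/subsetP => x xj.
have := F1 j; rewrite -leqNgt => /card_le1P-/(_ x xj) Fj.
have := fF j; rewrite Fj -fij inE => /eqP <-; exact: fF.
Qed.

(** Hall's condition for the row supports is a double count: the rows in [X] have total weight
    $(n+1)|X|$, all of it inside the columns of [Y], whose total weight is $(n+1)|Y|$. *)
Lemma regular_matching {T : finType} (n : nat) (M : T -> T -> nat) :
  (forall t, \sum_u M t u = n.+1) -> (forall u, \sum_t M t u = n.+1) ->
  exists f : T -> T, injective f /\ forall t, 0 < M t (f t).
Proof.
move=> hrow hcol; pose F t := [set u | 0 < M t u].
have [X|f [injf fF]] := hall F; last first.
  by exists f; split=> // t; have := fF t; rewrite inE.
set Y := \bigcup_(i in X) F i.
rewrite -(leq_pmul2r (ltn0Sn n)) -[leqLHS]sum_nat_const -[leqRHS]sum_nat_const.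
rewrite -(eq_bigr _ (fun t _ => hrow t)) -(eq_bigr _ (fun u _ => hcol u)).
rewrite [leqRHS]exchange_big /= [leqRHS](bigID (mem X)) /=.
apply: leq_trans (leq_addr _ _); apply: leq_sum => t tX.
rewrite (bigID (mem Y)) /= [X in _ + X]big1 ?addn0 // => u uY.
apply/eqP; rewrite -leqn0 leqNgt; apply: contraNN uY => Mtu.
by apply/bigcupP; exists t => //; rewrite inE.
Qed.

Lemma sum_eq_op {T : finType} (x : T) : \sum_(u : T) (x == u) = 1.
Proof.
rewrite (bigD1 x) //= eqxx big1 ?addn0 // => u.
by rewrite eq_sym => /negPf->.
Qed.

Lemma sum_inj_eq_op {T : finType} (f : T -> T) (u : T) :
  injective f -> \sum_(t : T) (f t == u) = 1.
Proof.
move=> /injF_bij [g fK gK]; rewrite -[RHS](sum_eq_op (g u)).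
by apply: eq_bigr => t _; rewrite (can2_eq fK gK) eq_sym.
Qed.

Lemma regular_sum_injective {T : finType} (n : nat) (M : T -> T -> nat) :
  (forall t, \sum_u M t u = n) -> (forall u, \sum_t M t u = n) ->
  exists s : 'I_n -> T -> T, (forall i, injective (s i)) /\
    forall t u, M t u = \sum_(i < n) (s i t == u).
Proof.
elim: n M => [|n IHn] M hrow hcol.
  exists (fun _ => id); split=> [[]//|t u]; rewrite big_ord0.
  by apply/eqP; rewrite -leqn0 -(hrow t) (bigD1 u) //= leq_addr.
have [f [injf Mf]] := regular_matching n M hrow hcol.
(* This makes the truncated subtraction of the permutation matrix of [f] exact, so the remainder has
   all row and column sums [n]. *)
have le_fM t u : (f t == u) <= M t u by case: eqP => // <-.
case: (IHn (fun t u => M t u - (f t == u))) => [t|u|s [injs hs]].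
- by rewrite sumnB // hrow sum_eq_op subn1.
- by rewrite sumnB // hcol sum_inj_eq_op // subn1.
exists (fun i => if unlift ord0 i is Some j then s j else f); split=> [i|t u].
  by case: unlift.
rewrite big_ord_recl unlift_none -[LHS](subnKC (le_fM t u)) hs.
by congr (_ + _); apply: eq_bigr => i _; rewrite liftK.
Qed.

Lemma has_sum_sum {D : choiceType} {I : finType} (f : I -> D -> nat)
    (c : I -> nat) :
  (forall i, has_sum (f i) (c i)) ->
  has_sum (fun x => \sum_i f i x) (\sum_i c i).
Proof.
move=> /fin_all_exists [A hA].
exists (\bigcup_(i <- enum I) A i)%fset => B /bigfcupsP AB.
rewrite exchange_big /=; apply: eq_bigr => i _.
by apply: hA; apply: AB; rewrite ?mem_enum.
Qed.

(** The union of the witness sets serves every [i]. Adding a further point to it leaves each sum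
    unchanged, so every [f i] vanishes there. *)
Lemma has_sum_common_support {D : choiceType} {I : finType} (f : I -> D -> nat)
    (c : I -> nat) :
  (forall i, has_sum (f i) (c i)) ->
  exists B : {fset D}, forall i,
    \sum_(x : B) f i (val x) = c i /\ forall x, x \notin B -> f i x = 0.
Proof.
move=> /fin_all_exists [A hA].
exists (\bigcup_(i <- enum I) A i)%fset => i;
set B := (\bigcup_(i <- enum I) _)%fset.
have AB : (A i `<=` B)%fset by apply: bigfcup_sup; rewrite ?mem_enum.
have hB := hA i B AB; split=> [|x xB]; first by rewrite -hB big_seq_fsetE.
have := hA i (x |` B)%fset (fsubset_trans AB (fsubsetU1 x B)).
rewrite big_fsetU1 //= hB; lia.
Qed.

Lemma has_sum_eq_op {D : choiceType} (x : D) : has_sum (fun y => x == y : nat) 1.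
Proof.
exists [fset x]%fset => B; rewrite fsub1set => xB.
rewrite (big_rem x) //= eqxx big_seq big1 // => y.
by rewrite mem_rem_uniq ?fset_uniq // inE eq_sym => /andP [/negPf->].
Qed.

Lemma histogram_sum {D : choiceType} {S : {fset D}} (n : nat)
    (G : 'I_n -> S * D -> nat) :
  (forall i, simple_histogram (G i)) ->
  histogram n (fun p => \sum_(i < n) G i p).
Proof.
move=> hG; split=> [a|b].
  have := has_sum_sum (fun i b => G i (a, b)) (fun=> 1) (fun i => (hG i).1 a).
  by rewrite sum1_card card_ord.
rewrite exchange_big /= -[leqRHS]card_ord -sum1_card.
by apply: leq_sum => i _; apply: (hG i).2.
Qed.

Definition completion {S B : finType} (n : nat) (H : S -> B -> nat)
    (t u : S + B) : nat :=
  match t, u with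
  | inl a, inl _ => 0
  | inl a, inr b | inr b, inl a => H a b
  | inr b, inr b' => (b == b') * (n - \sum_a H a b)
  end.

Lemma completion_sym {S B : finType} (n : nat) (H : S -> B -> nat) t u :
  completion n H t u = completion n H u t.
Proof.
case: t u => [a|b] [a'|b'] //=; rewrite [b' == b]eq_sym.
by case: eqVneq => [->|].
Qed.

Lemma completion_row {S B : finType} (n : nat) (H : S -> B -> nat) :
  (forall a, \sum_b H a b = n) -> (forall b, \sum_a H a b <= n) ->
  forall t, \sum_u completion n H t u = n.
Proof.
move=> hrow hcol [a|b]; rewrite big_sumType /=;
  first by rewrite big1 // add0n hrow.
(* The bound on column sums keeps the diagonal entry from being truncated. *)
by rewrite -big_distrl /= sum_eq_op mul1n subnKC.
Qed.

Lemma histogram_decomposition {D : choiceType} {S : {fset D}} (n : nat)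
    (H : S * D -> nat) :
  histogram n H ->
  exists G : 'I_n -> S * D -> nat,
    (forall i, simple_histogram (G i)) /\
    forall a b, H (a, b) = \sum_(i < n) G i (a, b).
Proof.
case=> /has_sum_common_support [B hB] hcol.
pose K (a : S) (b : B) := H (a, val b).
have hrow := completion_row n K (fun a => (hB a).1) (fun b => hcol (val b)).
case: (regular_sum_injective n (completion n K) hrow) => [u|s [injs hs]].
  by rewrite -[RHS](hrow u); apply: eq_bigr => t _; apply: completion_sym.
(* The upper left block is zero, so no permutation in the sum maps [S] into [S]. *)
have s_inl i a : exists b, s i (inl a) = inr b.
  case E: (s i (inl a)) => [a'|b]; last by exists b.
  by have := hs (inl a) (inl a'); rewrite (bigD1 i) //= E eqxx.
have [f hf] := fin_all_exists (fun i => fin_all_exists (s_inl i)).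
exists (fun i p => val (f i p.1) == p.2); split=> [i|a b] /=.
  split=> [a|b]; first exact: (has_sum_eq_op (val (f i a))).
  (* Injectivity of [s i] leaves at most one row with a [1] in column [b]. *)
  have [/existsP [a /= fa]|/existsPn h] := boolP [exists a, val (f i a) == b].
    rewrite (bigD1 a) //= fa big1 // => a' a'a; apply/eqP; rewrite eqb0.
    apply: contraNN a'a => /eqP fa'; apply/eqP.
    have E : f i a' = f i a by apply: val_inj; rewrite /= fa' (eqP fa).
    suff: inl a' = inl a :> S + B by case.
    by apply: (injs i); rewrite !hf E.
  by rewrite big1 // => a _; apply/eqP; rewrite eqb0 h.
(* Outside the common support both sides are zero, as every [f i a] lies in [B]. *)
have [bB|bB] := boolP (b \in B); last first.
  rewrite (hB a).2 // big1 // => i _; apply/eqP; rewrite eqb0.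
  by apply: contraNN bB => /eqP <-; apply: valP.
have := hs (inl a) (inr [` bB]%fset); rewrite /= /K /= => ->.
by apply: eq_bigr => i _; rewrite hf.
Qed.

Theorem theorem3 (D : countType) (S : {fset D}) (n : nat) (H : S * D -> nat) :
  histogram n H <->
  exists G : 'I_n -> (S * D -> nat),
    (forall i : 'I_n, simple_histogram (G i)) /\
    (forall (a : S) (b : D), H (a, b) = \sum_(i < n) G i (a, b)).
Proof.
split=> [|[G [hG HG]]]; first exact: histogram_decomposition.
(* [H] agrees with the sum only pointwise, so both conditions are carried over under the sums. *)
have [hrow hcol] := histogram_sum n G hG; split=> [a|b].
  by have [A hA] := hrow a; exists A => B /hA <-; apply: eq_bigr => b _.
by rewrite (eq_bigr _ (fun a _ => HG a b)).
Qed.
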